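(* Let $\mathcal{W}_t\subseteq\Omega_t$ be any retained set of worlds, and let $\overline{\mathcal{W}}_t=\mathcal{W}_t/{\sim_t}$, where each $\sim_t$-equivalence class in $\mathcal{W}_t$ is represented by any one of its members (so $\overline{\mathcal{W}}_t$ is identified with a subset of $\mathcal{W}_t$ containing exactly one element of each class). Then $$\mathcal{C}(\mathcal{W}_t)=\mathcal{C}(\overline{\mathcal{W}}_t).$$
   Context: Fix a set $\mathcal{A}_t$ of candidate actions, a set $\Omega_t$ of worlds, and for each $\omega\in\Omega_t$ a set $\Gamma_t(\omega)\subseteq\mathcal{A}_t$ of actions that are safely admissible in $\omega$. The action signature of a world is $\sigma_t(\omega)=\bigl(\mathbf{1}[a\in\Gamma_t(\omega)]\bigr)_{a\in\mathcal{A}_t}$. Two worlds are safety-equivalent, written $\omega\sim_t\omega'$, when $\sigma_t(\omega)=\sigma_t(\omega')$. For a set of worlds $\mathcal{W}\subseteq\Omega_t$, the certified action set is $$\mathcal{C}(\mathcal{W})=\{a\in\mathcal{A}_t:\ \forall\,\omega\in\mathcal{W},\ a\in\Gamma_t(\omega)\}.$$ *)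

(* Defs.v *)
(* The set of candidate actions and the set of worlds, at a fixed time, are
   arbitrary types [Act] and [World]; [Gamma w : set Act] is the set of actions
   safely admissible in [w]. *)
From mathcomp Require Import all_boot.
From mathcomp Require Import boolp classical_sets.

Set Implicit Arguments.
Unset Strict Implicit.
Unset Printing Implicit Defensive.

Local Open Scope classical_set_scope.

(* The indicator 1[a \in Gamma w] is boolean-valued; membership in a classical
   set is decided classically. *)
Definition signature (Act World : Type) (Gamma : World -> set Act)
    (w : World) : Act -> bool :=
  fun a => a \in Gamma w.

Definition safety_equiv (Act World : Type) (Gamma : World -> set Act)
    (w w' : World) : Prop :=
  signature Gamma w = signature Gamma w'.

Definition certified (Act World : Type) (Gamma : World -> set Act)
    (W : set World) : set Act :=
  [set a | forall w, W w -> Gamma w a].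

Definition safety_class (Act World : Type) (Gamma : World -> set Act)
    (W : set World) (w : World) : set World :=
  [set w' | W w' /\ safety_equiv Gamma w w'].

Definition safety_quotient (Act World : Type) (Gamma : World -> set Act)
    (W : set World) : set (set World) :=
  [set safety_class Gamma W w | w in W].

(* [Wbar] picks one arbitrary member of each class of the quotient of [W]. *)
Definition represents_quotient (Act World : Type) (Gamma : World -> set Act)
    (W Wbar : set World) : Prop :=
  Wbar `<=` W /\
  forall E, safety_quotient Gamma W E -> exists! w, E w /\ Wbar w.

(* Main.v *)
Require Import Defs.
From mathcomp Require Import all_boot.
From mathcomp Require Import boolp classical_sets.

(** Certification is antitone in the set of worlds, which gives one inclusion. For the other, each
    world of [W] has the same signature as the representative of its class, so by
    [safety_equiv_admissible] an action admissible at the representative is admissible at that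
    world. *)

Lemma safety_equiv_admissible (Act World : Type) (Gamma : World -> set Act)
    (w w' : World) (a : Act) :
  safety_equiv Gamma w w' -> Gamma w' a -> Gamma w a.
Proof.
move=> eq_sig Gw'a.
have := congr1 (fun s : Act -> bool => s a) eq_sig.
by rewrite /signature (mem_set Gw'a) => /set_mem.
Qed.

Theorem proposition3 (Act World : Type) (Gamma : World -> set Act)
    (W Wbar : set World)
    (hWbar : represents_quotient Gamma W Wbar) :
  certified Gamma W = certified Gamma Wbar.
Proof.
case: hWbar => sub_W repr_W; apply/seteqP; split=> a cert_a w Ww.
  exact/cert_a/sub_W.
(* Here [w'] is the representative in [Wbar] of the class of [w]; [a] is certified there and
   transfers back to [w]. *)
have [|w' [[[_ ww'] Wbar_w'] _]] := repr_W (safety_class Gamma W w).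
  by exists w.
exact: safety_equiv_admissible ww' (cert_a _ Wbar_w').
Qed.
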